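(* Let $x^1,\dots,x^T$ be a sequence, revealed online, where each $x^t\in\mathbb{R}^m_+$ is a fractional set cover of $U^t$, and let $x^0=0$, $\mathcal S^0=\emptyset$. Then: (1) There is a deterministic dynamic rounding scheme maintaining set covers $\mathcal S^t$ of $U^t$ such that $\sum_{t\in[T]}|\mathcal S^t\oplus\mathcal S^{t-1}|\le O(f)\sum_{t\in[T]}\|x^t-x^{t-1}\|_1$ and $\sum_{S\in\mathcal S^t}c(S)\le O(f)\sum_{i\in[m]}c(S_i)x_i^t$ for all $t\in[T]$, where $f\ge\max_{u\in U^t}|\{i\in[m]:u\in S_i\}|$ for all $t$. (2) For every $\alpha\ge1$, there is a randomized dynamic rounding scheme maintaining set covers $\mathcal S^t$ of $U^t$ such that $\mathbb E\left[\sum_{t\in[T]}|\mathcal S^t\oplus\mathcal S^{t-1}|\right]\le O(\log(\alpha n))\sum_{t\in[T]}\|x^t-x^{t-1}\|_1+O(T/\alpha)$ and $\mathbb E\left[\sum_{S\in\mathcal S^t}c(S)\right]\le O(\log(\alpha n))\sum_{i\in[m]}c(S_i)x_i^t$ for all $t\in[T]$, where $n\ge\max_t|U^t|$.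
   Context: Dynamic set cover: sets $S_1,\dots,S_m$ with costs $c(S_i)\ge 0$; at each time $t\in[T]$ one element is inserted into or deleted from the current universe, giving $U^t$; every element of $U^t$ lies in at least one $S_i$. A fractional set cover of $U^t$ is $x\in\mathbb{R}^m_+$ with $\sum_{i:u\in S_i}x_i\ge1$ for every $u\in U^t$. A dynamic rounding scheme chooses at each time $t$ a collection $\mathcal S^t\subseteq\{S_1,\dots,S_m\}$ covering $U^t$, depending only on $x^1,\dots,x^t$ (and its own randomness); $\oplus$ denotes symmetric difference.
   Formalization: In part (2) the scheme sees U^1,…,U^t as well as x^1,…,x^t (with x alone the claim is false), and O(log(αn)) is read as O(1+log(αn)), since the literal bound is 0 and fails at α=n=1. *)

(* Defs.v *)
From HB Require Import structures.
From mathcomp Require Import all_boot all_order all_algebra finmap.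
From mathcomp Require Import all_classical all_reals all_analysis.

Set Implicit Arguments.
Unset Strict Implicit.
Unset Printing Implicit Defensive.

Import Order.TTheory GRing.Theory Num.Theory.

Local Open Scope ring_scope.

(* The set system is an indexed family [S : 'I_m -> set E]; a collection of
   sets is the finite set of their indices, so two indices carrying the same
   subset of [E] are counted separately, as are their costs. *)
Section SetCover.
Variables (R : realType) (E : choiceType) (m : nat).
Implicit Types (S : 'I_m -> set E) (V W : {fset E}) (x : 'rV[R]_m)
  (A B : {set 'I_m}).

Definition frequency S (u : E) : nat := #|[pred i | u \in S i]|.

Definition coverable S V : Prop :=
  forall u, u \in V -> exists i, u \in S i.

Definition set_cover S V A : Prop :=
  forall u, u \in V -> exists2 i, i \in A & u \in S i.

Definition fractional_set_cover S V x : Prop :=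
  (forall i, 0 <= x ord0 i) /\
  (forall u, u \in V -> 1 <= \sum_(i | u \in S i) x ord0 i).

Definition cost (c : 'I_m -> R) A : R := \sum_(i in A) c i.

Definition fractional_cost (c : 'I_m -> R) x : R := \sum_i c i * x ord0 i.

(* The norm that the library puts on ['rV[R]_m] is the maximum norm. *)
Definition l1norm x : R := \sum_i `|x ord0 i|.

Definition symdiff A B : {set 'I_m} := (A :\: B) :|: (B :\: A).

Definition universe_update V W : Prop :=
  (exists2 e, e \notin V & W = (e |` V)%fset) \/
  (exists2 e, e \in V & W = (V `\ e)%fset).

(* Time steps are 1, ..., T.  [U 0] is the universe before the first update;
   nothing is required of it. *)
Definition dynamic_instance S (T : nat) (U : nat -> {fset E}) : Prop :=
  forall t, (1 <= t <= T)%N ->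
    universe_update (U t.-1) (U t) /\ coverable S (U t).

Definition fractional_solution S (T : nat) (U : nat -> {fset E})
    (x : nat -> 'rV[R]_m) : Prop :=
  x 0%N = 0 /\
  forall t, (1 <= t <= T)%N -> fractional_set_cover S (U t) (x t).

Definition movement (T : nat) (x : nat -> 'rV[R]_m) : R :=
  \sum_(1 <= t < T.+1) l1norm (x t - x t.-1).

Definition recourse (T : nat) (C : nat -> {set 'I_m}) : nat :=
  (\sum_(1 <= t < T.+1) #|symdiff (C t) (C t.-1)|)%N.

End SetCover.

(* An online scheme maps the list of everything revealed so far to the
   collection kept now.  [X] is the type of what is revealed at one step. *)
Definition scheme (X : Type) (m : nat) : Type := seq X -> {set 'I_m}.

Definition run (X : Type) (m : nat) (A : scheme X m) (z : nat -> X) (t : nat) :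
    {set 'I_m} :=
  if t is 0 then finset.set0 else A [seq z s | s <- iota 1 t].

(* A randomized scheme is a family of schemes indexed by a random seed, whose
   output on each history is a random variable.  The seed is drawn
   independently of the input. *)
Definition measurable_scheme (d : measure_display) (Omega : measurableType d)
    (X : Type) (m : nat) (A : Omega -> scheme X m) : Prop :=
  forall (h : seq X) (B : {set 'I_m}),
    measurable [set w | A w h = B]%classic.

(* Main.v *)
(* Part (1) is hysteresis: a set enters the cover when [x_i >= 1/f] and leaves
   it when [x_i < 1/(2f)], so between two switches [x_i] moves by at least
   [1/(2f)].  Part (2) gives each set an independent exponential threshold of
   rate [rho = 1 + ln (alpha n)] and selects it while its threshold is at most
   [x_i]; a set is then selected with probability at most [rho x_i], it switches
   with probability at most [rho |x_i^t - x_i^(t-1)|], and an element is missed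
   with probability at most [exp (- rho) <= 1/(alpha n)].  Each missed element is
   covered by a cheapest set containing it, whose cost is at most that of the
   whole fractional solution. *)
Require Import Defs.
From HB Require Import structures.
From mathcomp Require Import all_boot all_order all_algebra finmap.
From mathcomp Require Import all_classical all_reals all_analysis.
From mathcomp Require Import measurable_realfun ring lra.

Set Implicit Arguments.
Unset Strict Implicit.
Unset Printing Implicit Defensive.

Import Order.TTheory GRing.Theory Num.Theory.

Local Open Scope ring_scope.

(** * Switch counts, movement and runs, one step at a time *)

Lemma card_symdiff (m : nat) (A B : {set 'I_m}) :
  #|symdiff A B| = (\sum_i ((i \in A) != (i \in B)))%N.
Proof.
rewrite -sum1_card big_mkcond /=; apply: eq_bigr => i _; rewrite !inE.
by case: (i \in A); case: (i \in B).
Qed.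

Lemma recourseS (m T : nat) (C : nat -> {set 'I_m}) :
  recourse T.+1 C = (recourse T C + #|symdiff (C T.+1) (C T)|)%N.
Proof. exact: big_nat_recr. Qed.

Lemma movementS (R : realType) (m T : nat) (x : nat -> 'rV[R]_m) :
  movement T.+1 x = movement T x + l1norm (x T.+1 - x T).
Proof. exact: big_nat_recr. Qed.

Lemma run_seq (X : Type) (m : nat) (A : scheme X m) (z : nat -> X) (t : nat) :
  run A z t.+1 = A (rcons [seq z s | s <- iota 1 t] (z t.+1)).
Proof. by rewrite /run -map_rcons -cats1 -(iotaD 1 t 1) addn1. Qed.

(** * Deterministic rounding by hysteresis *)

Section Hysteresis.
Variables (R : realType) (m f : nat).
Implicit Types (B : {set 'I_m}) (x : 'rV[R]_m).

(** Both thresholds are multiplied out by [f], so no division occurs, and [f = 0] selects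
    nothing. *)
Definition hysteresis B x : {set 'I_m} :=
  [set i | (1 <= f%:R * x ord0 i) || (i \in B) && (1 <= 2 * (f%:R * x ord0 i))].

Definition hysteresis_scheme : scheme 'rV[R]_m m := foldl hysteresis finset.set0.

Lemma run_hysteresisS (x : nat -> 'rV[R]_m) (t : nat) :
  run hysteresis_scheme x t.+1 =
  hysteresis (run hysteresis_scheme x t) (x t.+1).
Proof. by rewrite run_seq /hysteresis_scheme foldl_rcons; case: t. Qed.

(* The movement already paid towards the next switch of a set that is in the
   cover iff [b], in units of [1/(2f)]; [p] stands for [f x_i]. *)
Definition potential (b : bool) (p : R) : R :=
  Num.max 0 (if b then 2 - 2 * p else 2 * p - 1).

(** For fixed [b] the potential is 2-Lipschitz in [p]. At a switch it drops from at least 1 to 0,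
    and this drop pays for the switch: entering needs [q >= 1], where [2 * q - 1 >= 1], and leaving
    needs [q < 1/2], where [2 - 2 * q > 1]. *)
Lemma potential_step (b : bool) (p q : R) :
  let b' := (1 <= q) || b && (1 <= 2 * q) in
  (b' != b)%:R + potential b' q <= potential b p + 2 * `|q - p|.
Proof.
have h1 : q - p <= `|q - p| by exact: ler_norm.
have h2 : p - q <= `|q - p| by rewrite distrC; exact: ler_norm.
have pos (r : R) : r <= Num.max 0 r by rewrite le_max lexx orbT.
have pos0 (r : R) : 0 <= Num.max 0 r by rewrite le_max lexx.
have maxl (r s : R) : 0 <= s -> r <= s -> Num.max 0 r <= s.
  by move=> s0 rs; rewrite ge_max s0.
rewrite /potential /=; case: (lerP 1 q) => q1; case: (lerP 1 (2 * q)) => q2;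
  case: b => /=; rewrite ?addr0 ?add0r.
all: rewrite -?lerBrDl; apply: maxl.
all: have := pos (2 - 2 * p); have := pos0 (2 - 2 * p);
  have := pos (2 * p - 1); have := pos0 (2 * p - 1); lra.
Qed.

(** Amortization: [potential_step] is summed over all sets and telescoped over time. The initial
    potential vanishes because the cover is empty and [x 0 = 0]. *)
Lemma recourse_potential (x : nat -> 'rV[R]_m) (T : nat) : x 0%N = 0 ->
  (recourse T (run hysteresis_scheme x))%:R
  + \sum_i potential (i \in run hysteresis_scheme x T) (f%:R * x T ord0 i)
  <= 2 * f%:R * movement T x.
Proof.
move=> x0; elim: T => [|T IH].
  rewrite /recourse /movement !big_geq// mulr0 add0r big1// => i _.
  rewrite finset.inE x0 mxE mulr0 /potential mulr0 sub0r.
  by rewrite max_l// oppr_le0.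
rewrite recourseS movementS run_hysteresisS mulrDr natrD -addrA.
apply: le_trans _ (lerD IH (lexx _)); rewrite -addrA lerD2l.
rewrite card_symdiff natr_sum -big_split /= /l1norm mulr_sumr -big_split /=.
apply: ler_sum => i _; rewrite !mxE !inE.
apply: le_trans (potential_step _ (f%:R * x T ord0 i) _) _.
by rewrite -mulrBr normrM normr_nat mulrA.
Qed.

Lemma hysteresis_recourse (x : nat -> 'rV[R]_m) (T : nat) : x 0%N = 0 ->
  (recourse T (run hysteresis_scheme x))%:R <= 2 * f%:R * movement T x.
Proof.
move=> x0; apply: le_trans _ (recourse_potential T x0); rewrite lerDl.
by apply: sumr_ge0 => i _; rewrite le_max lexx.
Qed.

(** The upper threshold alone ensures coverage, whatever [B] is: were [f x_i < 1] for every set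
    containing [u], then [f <= \sum f x_i < frequency S u <= f]. *)
Lemma hysteresis_set_cover (E : choiceType) (S : 'I_m -> set E) (V : {fset E})
    B x :
  fractional_set_cover S V x -> (forall u, u \in V -> (frequency S u <= f)%N) ->
  set_cover S V (hysteresis B x).
Proof.
move=> [x_ge0 x_cov] freq u uV.
have [[i] | none] := pselect (exists i, u \in S i /\ 1 <= f%:R * x ord0 i).
  by move=> [uSi fx]; exists i => //; rewrite inE fx.
have fx i : u \in S i -> f%:R * x ord0 i < 1.
  by move=> uSi; rewrite ltNge; apply/negP => fx; apply: none; exists i.
(* Strictness of the summed inequality needs a nonempty range; an empty one would turn the covering
   constraint into [1 <= 0]. *)
have S_has : has (fun i => u \in S i) (index_enum 'I_m).
  by apply: contraTT (x_cov u uV) => noS; rewrite big_hasC// -ltNge.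
suff : f%:R < f%:R :> R by rewrite ltxx.
apply: (@le_lt_trans _ _ (\sum_(i | u \in S i) f%:R * x ord0 i)).
  by rewrite -mulr_sumr ler_peMr// x_cov.
apply: (@lt_le_trans _ _ (\sum_(i | u \in S i) 1)).
  by apply: ltr_sum => [|i]; [exact: S_has | exact: fx].
by rewrite sumr_const ler_nat; exact: freq.
Qed.

(** Newly entered or kept, a selected set satisfies [1 <= 2 * (f x_i)], so its cost is charged to
    its own fractional term. *)
Lemma hysteresis_cost (c : 'I_m -> R) B x :
  (forall i, 0 <= c i) -> (forall i, 0 <= x ord0 i) ->
  cost c (hysteresis B x) <= 2 * f%:R * fractional_cost c x.
Proof.
move=> c0 x0; rewrite /cost /fractional_cost mulr_sumr big_mkcond /=.
apply: ler_sum => i _; rewrite inE.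
have x1 : 0 <= f%:R * x ord0 i by rewrite mulr_ge0.
rewrite [leRHS](_ : _ = c i * (2 * (f%:R * x ord0 i))); last by lra.
case: ifPn => [|_]; last by rewrite !mulr_ge0.
by move=> fx; rewrite ler_peMr//; case/orP: fx => [|/andP[]]; lra.
Qed.

End Hysteresis.

(** * Finitely many independent copies of a law *)

Lemma iid_copies (R : realType) (d0 : measure_display) (T0 : measurableType d0)
    (Q : probability T0 R) (m : nat) :
  exists (d : measure_display) (Omega : measurableType d)
         (P : probability Omega R) (X : 'I_m -> Omega -> T0),
    (forall i, measurable_fun setT (X i)) /\
    forall A : 'I_m -> set T0, (forall i, measurable (A i)) ->
      P [set w | forall i, A i (X i w)]%classic = (\prod_i fine (Q (A i)))%:E.
Proof.
elim: m => [|m [d [ Omega [P [X [mX indX]]]]]].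
  (* With no coordinates any probability space serves; [Q] itself is at hand. *)
  exists d0, T0, Q, (fun=> id); split => // A _; rewrite big_ord0.
  rewrite (_ : [set w | _]%classic = setT) ?probability_setT//.
  by apply/seteqP; split => // w _ [].
(* The new copy is the first factor, read at index [ord0]; the earlier copies are read off the
   second factor. A rectangle condition then splits as a product set, whose measure factors. *)
exists _, (T0 * Omega)%type, (Q \x P)%E,
  (fun i w => if unlift ord0 i is Some j then X j w.2 else w.1).
split=> [i|A mA].
  case: (unlift ord0 i) => [j|]; last exact: measurable_fst.
  by apply: measurableT_comp; [exact: mX | exact: measurable_snd].
rewrite (_ : [set w | _]%classic =
    (A ord0 `*` [set w | forall j, A (lift ord0 j) (X j w)])%classic); last first.
  apply/seteqP; split=> [w Aw|w [/= Aw1 Aw2] i].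
    split=> [|j]; first by have := Aw ord0; rewrite unlift_none.
    by have := Aw (lift ord0 j); rewrite liftK.
  by case: unliftP => [j ->|->]; [exact: Aw2 | exact: Aw1].
rewrite [LHS]product_measure1E//; last first.
  rewrite (_ : [set w | _]%classic =
      (\bigcap_(j in [set: 'I_m]) (X j @^-1` A (lift ord0 j)))%classic).
    apply: fin_bigcap_measurable => // j _.
    by rewrite -[X in measurable X]setTI; exact: mX.
  by apply/seteqP; split => w Aw j; [move=> _|]; exact: Aw.
rewrite [X in (_ * X)%E](indX (fun j => A (lift ord0 j))) => [|j]; last exact: mA.
by rewrite big_ord_recl EFinM fineK// fin_num_measure.
Qed.

(** * Bounds on means, and random variables with finitely many values *)

Section Mean.
Variables (R : realType) (d : measure_display) (Omega : measurableType d).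
Variable P : probability Omega R.

(** Measurability and nonnegativity are bundled with the bound so that bounds add up without
    integrability conditions. *)
Definition mean_le (g : Omega -> R) (b : R) : Prop :=
  [/\ measurable_fun setT g, forall w, 0 <= g w & ('E_P[g] <= b%:E)%E].

Lemma mean_leD (g h : Omega -> R) (b b' : R) :
  mean_le g b -> mean_le h b' -> mean_le (fun w => g w + h w) (b + b').
Proof.
move=> [mg g0 Eg] [mh h0 Eh].
split; [exact: measurable_funD | by move=> w; rewrite addr_ge0 |].
move: Eg Eh; rewrite unlock => Eg Eh.
under eq_integral do rewrite EFinD.
rewrite ge0_integralD//; [by rewrite EFinD leeD | | | |].
- by move=> w _; rewrite lee_fin.
- exact/measurable_EFinP.
- by move=> w _; rewrite lee_fin.
- exact/measurable_EFinP.
Qed.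

Lemma mean_le_sum (I : Type) (s : seq I) (p : pred I) (g : I -> Omega -> R)
    (b : I -> R) :
  (forall i, p i -> mean_le (g i) (b i)) ->
  mean_le (fun w => \sum_(i <- s | p i) g i w) (\sum_(i <- s | p i) b i).
Proof.
move=> gb; elim: s => [|i s IH].
  rewrite big_nil; under eq_fun do rewrite big_nil.
  by split=> //; rewrite ?expectation_cst.
rewrite big_cons; under eq_fun do rewrite big_cons.
by case: ifP => // pi; apply: mean_leD => //; exact: gb.
Qed.

Lemma mean_le_sum_seq (I : eqType) (s : seq I) (g : I -> Omega -> R)
    (b : I -> R) :
  (forall i, i \in s -> mean_le (g i) (b i)) ->
  mean_le (fun w => \sum_(i <- s) g i w) (\sum_(i <- s) b i).
Proof.
by move=> gb; rewrite big_seq; under eq_fun do rewrite big_seq; exact: mean_le_sum.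
Qed.

Lemma mean_le_event (p : pred Omega) (a b : R) :
  0 <= a -> measurable [set w | p w]%classic ->
  (P [set w | p w]%classic <= b%:E)%E ->
  mean_le (fun w => (p w)%:R * a) (b * a).
Proof.
move=> a0 mp Pp.
have E : (fun w => (p w)%:R * a) = (fun w => \1_[set w | p w]%classic w * a).
  apply/funext => w; rewrite indicE; congr ((nat_of_bool _)%:R * _).
  by apply/idP/idP; rewrite inE.
split; [rewrite E; apply: measurable_funM => // | |].
- by move=> w; rewrite mulr_ge0.
- rewrite E unlock.
  under eq_integral do rewrite EFinM.
  rewrite ge0_integralZr//.
  + by rewrite integral_indic// setIT EFinM lee_wpmul2r// lee_fin.
  + by apply/measurable_EFinP.
Qed.

Lemma mean_le_mono (g h : Omega -> R) (b b' : R) :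
  measurable_fun setT h -> (forall w, 0 <= h w <= g w) -> b <= b' ->
  mean_le g b -> mean_le h b'.
Proof.
move=> mh hg bb' [mg g0 Eg]; split=> //; first by move=> w; case/andP: (hg w).
rewrite (@le_trans _ _ b%:E)// (le_trans _ Eg)//.
apply: expectation_le => //; first by move=> w; case/andP: (hg w).
by apply: aeW => w; case/andP: (hg w).
Qed.

(** This is measurability for the discrete sigma-algebra on [F], stated without equipping [F] with
    one. It is stable under arbitrary maps between finite types. *)
Definition measurable_fibers (F : finType) (f : Omega -> F) : Prop :=
  forall a, measurable [set w | f w = a]%classic.

Lemma measurable_fibers_comp (F G : finType) (g : F -> G) (f : Omega -> F) :
  measurable_fibers f -> measurable_fibers (fun w => g (f w)).
Proof.
move=> mf b; rewrite (_ : [set w | _]%classic =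
  (\bigcup_(a in [set a | g a = b]) [set w | f w = a])%classic).
  by apply: fin_bigcup_measurable => //.
by apply/seteqP; split => [w /= <-|w [a /= <- ->]//]; exists (f w).
Qed.

Lemma measurable_fibers_pair (F G : finType) (f : Omega -> F) (g : Omega -> G) :
  measurable_fibers f -> measurable_fibers g ->
  measurable_fibers (fun w => (f w, g w)).
Proof.
move=> mf mg [a b]; rewrite (_ : [set w | _]%classic =
  ([set w | f w = a] `&` [set w | g w = b])%classic); first exact: measurableI.
by apply/seteqP; split => w /=; [case=> <- <- | case=> <- <-].
Qed.

Lemma measurable_fibers_fun (F : finType) (f : Omega -> F) (g : F -> R) :
  measurable_fibers f -> measurable_fun setT (fun w => g (f w)).
Proof.
move=> mf _ Y mY; rewrite setTI.
rewrite (_ : (_ @^-1` _)%classic =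
  (\bigcup_(a in [set a | Y (g a)]) [set w | f w = a])%classic).
  by apply: fin_bigcup_measurable => //.
by apply/seteqP; split => [w /= Yw|w [a /= Ya ->]//]; exists (f w).
Qed.

End Mean.

(** * Covering missed elements by cheapest sets *)

Section Patch.
Variables (R : realType) (E : choiceType) (m : nat).
Variables (S : 'I_m -> set E) (c : 'I_m -> R).
Implicit Types (A B D : {set 'I_m}) (V : {fset E}).

(** A collection of at most one index rather than an index: it is empty when [u] lies in no set, so
    no default index is needed. *)
Definition cheapest (u : E) : {set 'I_m} :=
  if [pick i | (u \in S i) && [forall j, (u \in S j) ==> (c i <= c j)]]
  is Some i then [set i]%SET else finset.set0.

Definition missed D (u : E) : bool := ~~ [exists (i | i \in D), u \in S i].

Definition fallback D V : {set 'I_m} :=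
  \big[@finset.setU _/finset.set0]_(u <- V | missed D u) cheapest u.

Lemma card_cheapest u : (#|cheapest u| <= 1)%N.
Proof. by rewrite /cheapest; case: pickP => [i _|_]; rewrite ?cards1 ?cards0. Qed.

Lemma cheapestP u i0 : u \in S i0 ->
  exists i, [/\ cheapest u = [set i]%SET, u \in S i &
    forall j, u \in S j -> c i <= c j].
Proof.
move=> uS; rewrite /cheapest; case: pickP => [i /andP[uSi /forallP ci]|none].
  by exists i; split => // j uSj; have := ci j; rewrite uSj.
have [i uSi ci] := arg_minP (P := fun i => u \in S i) c uS.
by have := none i; rewrite uSi => /negP[]; apply/forallP => j; apply/implyP/ci.
Qed.

Lemma cheapest_sub_fallback D V u :
  u \in V -> missed D u -> cheapest u \subset fallback D V.
Proof.
rewrite /fallback => uV uD; apply/fintype.subsetP => i iu.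
have {uV} : u \in enum_fset V by [].
elim: (enum_fset V) => [|v s IH]; first by rewrite in_nil.
rewrite in_cons big_cons => /orP[/eqP <-|us].
  by rewrite uD finset.inE iu.
by case: ifP => _; rewrite ?finset.inE IH ?orbT.
Qed.

Lemma fallback_set_cover D V : coverable S V -> set_cover S V (D :|: fallback D V).
Proof.
move=> cov u uV; have [uD|] := boolP (missed D u); last first.
  by rewrite negbK => /exists_inP[i iD uSi]; exists i => //; rewrite finset.inE iD.
have [i0 uSi0] := cov u uV.
have [i [ui uSi _]] := cheapestP uSi0.
exists i => //; rewrite finset.inE; apply/orP; right.
by apply: (fintype.subsetP (cheapest_sub_fallback uV uD)); rewrite ui finset.inE.
Qed.

Lemma card_fallback D V : (#|fallback D V| <= \sum_(u <- V) missed D u)%N.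
Proof.
rewrite /fallback; elim: (enum_fset V) => [|u s IH]; first by rewrite !big_nil cards0.
rewrite !big_cons; case: ifP => _ //.
by rewrite (leq_trans (leq_card_setU _ _))// leq_add// card_cheapest.
Qed.

Hypothesis c_ge0 : forall i, 0 <= c i.

Lemma cost_ge0 A : 0 <= cost c A. Proof. exact: sumr_ge0. Qed.

Lemma cost_setU A B : cost c (A :|: B) <= cost c A + cost c B.
Proof.
rewrite /cost !(big_mkcond (fun i => i \in _)) /= -big_split /=.
apply: ler_sum => i _; rewrite finset.inE; move: (c_ge0 i).
by case: (i \in A); case: (i \in B) => /=; lra.
Qed.

Lemma cost_fallback D V :
  cost c (fallback D V) <= \sum_(u <- V) (missed D u)%:R * cost c (cheapest u).
Proof.
rewrite /fallback; elim: (enum_fset V) => [|u s IH].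
  by rewrite !big_nil /cost big_set0.
rewrite !big_cons; case: ifP => _ /=; last by rewrite mul0r add0r.
by rewrite mul1r (le_trans (cost_setU _ _))// lerD2l.
Qed.

(** Averaging: the fractional weights of the sets containing [u] sum to at least 1, and each of
    these sets costs at least as much as the cheapest one. *)
Lemma cost_cheapest V (x : 'rV[R]_m) u :
  fractional_set_cover S V x -> u \in V ->
  cost c (cheapest u) <= fractional_cost c x.
Proof.
move=> [x0 xV] uV.
have term_ge0 i : 0 <= c i * x ord0 i by rewrite mulr_ge0.
have [[i0 uSi0]|none] := pselect (exists i, u \in S i); last first.
  (* If [u] lay in no set, its covering constraint would read [1 <= 0]. *)
  have := xV u uV; rewrite big1 ?ler10// => i uSi.
  by case: none; exists i.
have [i [-> _ ci]] := cheapestP uSi0.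
rewrite /cost big_set1 /fractional_cost (bigID (fun j => u \in S j)) /=.
apply: ler_wpDr; first exact: sumr_ge0.
apply: (@le_trans _ _ (\sum_(j | u \in S j) c i * x ord0 j)); last first.
  by apply: ler_sum => j uSj; rewrite ler_wpM2r// ci.
by rewrite -mulr_sumr ler_peMr// xV.
Qed.

End Patch.

(** Lets the fallback sets [A'] and [B'] of two consecutive times be charged in full, with no
    comparison between them. *)
Lemma card_symdiff_setU (m : nat) (A A' B B' : {set 'I_m}) :
  (#|symdiff (A :|: A') (B :|: B')| <= #|symdiff A B| + (#|A'| + #|B'|))%N.
Proof.
apply: (@leq_trans #|symdiff A B :|: (A' :|: B')|); last first.
  rewrite (leq_trans (leq_card_setU _ _))// leq_add2l.
  exact: leq_card_setU.
apply/subset_leq_card/fintype.subsetP => i; rewrite !finset.inE.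
by case: (i \in A); case: (i \in A'); case: (i \in B); case: (i \in B').
Qed.

(** * Selection by independent exponential thresholds *)

Lemma exponential_probability (R : realType) (rate : R) : 0 < rate ->
  exists Q : probability (measurableTypeR R) R,
    forall V, Q V = exponential_prob rate V.
Proof.
move=> rate0; unshelve eexists (exponential_prob rate : probability _ _).
  exact: rate0.
by [].
Qed.

Section Selection.
Variables (R : realType) (E : choiceType) (m : nat) (S : 'I_m -> set E).
Variables (rate : R) (d : measure_display) (Omega : measurableType d).
Variables (P : probability Omega R) (X : 'I_m -> Omega -> measurableTypeR R).
Hypothesis rate_gt0 : 0 < rate.
Hypothesis X_measurable : forall i, measurable_fun setT (X i).
Hypothesis X_independent : forall A : 'I_m -> set (measurableTypeR R),
  (forall i, measurable (A i)) ->
  P [set w | forall i, A i (X i w)]%classic =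
  (\prod_i fine (exponential_prob rate (A i)))%:E.

(* The condition [0 < r] makes level [0] select nothing, surely and not just
   almost surely, so that time [0] needs no special case. *)
Definition hit (i : 'I_m) (r : R) (w : Omega) : bool :=
  [&& 0 < r, 0 <= X i w :> R & X i w <= r :> R].

Definition selection (w : Omega) (x : 'rV[R]_m) : {set 'I_m} :=
  [set i | hit i (x ord0 i) w].

Definition band (r : R) : set (measurableTypeR R) :=
  [set s | [&& 0 < r, 0 <= s :> R & s <= r :> R]]%classic.

Lemma band_itv (r : R) : 0 < r -> band r = `[0, r]%classic.
Proof.
by move=> r0; apply/seteqP; split => s; rewrite /band /= r0 in_itv.
Qed.

Lemma band0 (r : R) : r <= 0 -> band r = set0.
Proof.
move=> r0; apply/seteqP; split => s //=.
by rewrite /band /= ltNge r0.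
Qed.

Lemma measurable_band (r : R) : measurable (band r).
Proof.
by have [r0|r0] := leP r 0; [rewrite band0 | rewrite band_itv//; exact: measurable_itv].
Qed.

Lemma exponential_prob_band (r : R) : 0 <= r ->
  exponential_prob rate (band r) = (1 - expR (- rate * r))%:E.
Proof.
rewrite le_eqVlt => /predU1P[<-|r0].
  by rewrite band0// mulr0 expR0 subrr /exponential_prob integral_set0.
by rewrite band_itv// exponential_prob_itv0c.
Qed.

Lemma exponential_prob_bandC (r : R) : 0 <= r ->
  exponential_prob rate (~` band r)%classic = (expR (- rate * r))%:E.
Proof.
move=> r0; have [Q QE] := exponential_probability rate_gt0.
rewrite -QE probability_setC; last exact: measurable_band.
by rewrite QE exponential_prob_band// -EFinB subKr.
Qed.

Lemma exponential_probT : exponential_prob rate [set: R]%classic = 1%:E.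
Proof. by have [Q <-] := exponential_probability rate_gt0; exact: probability_setT. Qed.

Lemma measurable_hit i r : measurable [set w | hit i r w]%classic.
Proof.
have -> : [set w | hit i r w]%classic = (setT `&` X i @^-1` band r)%classic.
  by rewrite setTI.
by apply: X_measurable => //; exact: measurable_band.
Qed.

Lemma prob_hit i r : 0 <= r ->
  P [set w | hit i r w]%classic = (1 - expR (- rate * r))%:E.
Proof.
move=> r0.
(* Constraining coordinate [i] alone makes every other factor 1, so the product formula yields the
   marginal law of [X i]. *)
pose A j := if j == i then band r else [set: measurableTypeR R]%classic.
have -> : [set w | hit i r w]%classic = [set w | forall j, A j (X j w)]%classic.
  apply/seteqP; split => w /=; last by move/(_ i); rewrite /A eqxx.
  by move=> hw j; rewrite /A; case: eqP => [->|].
rewrite X_independent; last first.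
  by move=> j; rewrite /A; case: ifP => _ //; exact: measurable_band.
rewrite (bigD1 i)//= big1 => [|j /negPf ji]; rewrite /A.
  by rewrite eqxx mulr1 exponential_prob_band.
by rewrite ji exponential_probT.
Qed.

(** The difference is [expR (- rate * r)], at most 1, times [1 - expR (- y)] with
    [y = rate * (s - r)], and [1 - y <= expR (- y)]. *)
Lemma expRN_lipschitz (r s : R) : 0 <= r <= s ->
  expR (- rate * r) - expR (- rate * s) <= rate * (s - r).
Proof.
move=> /andP[r0 rs].
have -> : - rate * s = - rate * r + - (rate * (s - r)) by ring.
rewrite expRD.
have h1 : 1 - rate * (s - r) <= expR (- (rate * (s - r))) by exact: expR_ge1Dx.
have h2 : expR (- rate * r) <= 1.
  by rewrite -expR0 ler_expR mulNr oppr_le0 mulr_ge0 // ltW.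
have h3 : 0 <= expR (- rate * r) by exact: expR_ge0.
have h4 : 0 <= rate * (s - r) by rewrite mulr_ge0 ?subr_ge0 // ltW.
have := ler_wpM2l h3 h1; have := ler_wpM2r h4 h2; lra.
Qed.

Lemma measurable_hit_neq i r s :
  measurable [set w | hit i r w != hit i s w]%classic.
Proof.
have -> : [set w | hit i r w != hit i s w]%classic =
    ([set w | hit i r w] `\` [set w | hit i s w] `|`
     ([set w | hit i s w] `\` [set w | hit i r w]))%classic.
  apply/seteqP; split => w /=; case: (hit i r w); case: (hit i s w) => //=.
  - by left.
  - by right.
  - by case=> -[].
  - by case=> -[].
by apply: measurableU; apply: measurableD; exact: measurable_hit.
Qed.

(** Hits are monotone in the level, so for [r <= s] the two disagree exactly when [s] is hit and [r]
    is not. The probability is then a difference of two values of [expR]. *)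
Lemma prob_hit_neq i r s : 0 <= r -> 0 <= s ->
  (P [set w | hit i r w != hit i s w]%classic <= (rate * `|s - r|)%:E)%E.
Proof.
wlog rs : r s / r <= s => [wlog_rs r0 s0|r0 s0].
  have [rs|/ltW sr] := leP r s; first exact: wlog_rs.
  under eq_set do rewrite eq_sym.
  by rewrite distrC; exact: wlog_rs.
have sub w : hit i r w -> hit i s w.
  move=> /and3P[r1 X0 Xr]; apply/and3P; split => //.
  - exact: lt_le_trans rs.
  - exact: le_trans rs.
have -> : [set w | hit i r w != hit i s w]%classic =
    ([set w | hit i s w] `\` [set w | hit i r w])%classic.
  apply/seteqP; split => w /=; have := sub w;
    case: (hit i r w); case: (hit i s w) => //= h;
    by [have := h isT | case].
rewrite [leLHS]measureD; [|exact: measurable_hit..|]; last first.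
  by rewrite -ge0_fin_numE ?measure_ge0// fin_num_measure//; exact: measurable_hit.
have -> : ([set w | hit i s w] `&` [set w | hit i r w])%classic =
    [set w | hit i r w]%classic.
  by apply/seteqP; split => w /= => [[]//|hw]; split => //; exact: sub.
rewrite [X in (X - _)%E](prob_hit i s0) [X in (_ - X)%E](prob_hit i r0).
rewrite -EFinB lee_fin ger0_norm ?subr_ge0//.
have := @expRN_lipschitz r s; rewrite r0 rs => /(_ isT); lra.
Qed.

(** By independence the probability is the product of [expR (- rate * x_j)] over the sets containing
    [u]. The exponents add up, and the covering constraint bounds their sum. *)
Lemma prob_missed V (x : 'rV[R]_m) u :
  fractional_set_cover S V x -> u \in V ->
  (P [set w | missed S (selection w x) u]%classic <= (expR (- rate))%:E)%E.
Proof.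
move=> [x0 xV] uV.
pose A j := if u \in S j then (~` band (x ord0 j))%classic
  else [set: measurableTypeR R]%classic.
have -> : [set w | missed S (selection w x) u]%classic =
    [set w | forall j, A j (X j w)]%classic.
  apply/seteqP; split => w /=.
    rewrite /missed negb_exists_in => /forall_inP mw j; rewrite /A.
    case: ifP => // uSj hj; have := mw j; rewrite uSj.
    by apply/implyP => //; rewrite inE.
  move=> Aw; rewrite /missed negb_exists_in; apply/forall_inP => j.
  rewrite inE => hj; apply/negP => uSj; have := Aw j; rewrite /A uSj.
  by apply.
rewrite X_independent; last first.
  move=> j; rewrite /A; case: ifP => _ //.
  by apply: measurableC; exact: measurable_band.
rewrite lee_fin (bigID (fun j => u \in S j)) /=.
rewrite [X in _ * X]big1 => [|j /negPf uSj]; last by rewrite /A uSj exponential_probT.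
rewrite (eq_bigr (fun j => expR (- rate * x ord0 j))) => [|j uSj]; last first.
  by rewrite /A uSj exponential_prob_bandC.
rewrite mulr1 -expR_sum ler_expR -mulr_sumr mulNr lerN2 ler_peMr ?xV//.
exact: ltW.
Qed.

Lemma measurable_fibers_selection x : measurable_fibers (selection^~ x).
Proof.
move=> D; have -> : [set w | selection w x = D]%classic =
    (\bigcap_(i in [set: 'I_m])
      (if i \in D then [set w | hit i (x ord0 i) w]
       else ~` [set w | hit i (x ord0 i) w]))%classic.
  apply/seteqP; split => w /=.
    by move=> <- i _; rewrite inE; case: ifP => // /negP.
  move=> h; apply/setP => i; rewrite inE; have := h i I.
  by case: ifP => // _ /negP/negPf.
apply: fin_bigcap_measurable => // i _; case: ifP => _.
  exact: measurable_hit.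
by apply: measurableC; exact: measurable_hit.
Qed.

Lemma selection0 w : selection w 0 = finset.set0.
Proof. by apply/setP => i; rewrite !inE mxE /hit ltxx. Qed.

(** * The randomized scheme: expected recourse and cost *)

Variable c : 'I_m -> R.
Hypothesis c_ge0 : forall i, 0 <= c i.
Implicit Types (U : nat -> {fset E}) (x : nat -> 'rV[R]_m) (T n : nat).

(** The same thresholds serve at all times, which keeps consecutive selections close; otherwise only
    the latest revealed pair matters. The default pair is met only on the empty history. *)
Definition rounding (w : Omega) : scheme ({fset E} * 'rV[R]_m) m :=
  fun h => let z := last (fset0, 0) h in
    selection w z.2 :|: fallback S c (selection w z.2) z.1.

(** Time 0 is set apart because [run] starts from the empty collection, while [U 0] is arbitrary and
    might call for a fallback. *)
Definition repair U x (t : nat) (w : Omega) : {set 'I_m} :=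
  if t is 0 then finset.set0 else fallback S c (selection w (x t)) (U t).

Lemma run_rounding U x t w : x 0%N = 0 ->
  run (rounding w) (fun t => (U t, x t)) t =
  selection w (x t) :|: repair U x t w.
Proof.
move=> x0; case: t => [|t]; first by rewrite x0 selection0 finset.setU0.
by rewrite run_seq /rounding last_rcons.
Qed.

Lemma measurable_rounding : measurable_scheme rounding.
Proof.
move=> h; rewrite -/(measurable_fibers _) /rounding.
exact: (measurable_fibers_comp
  (fun D => D :|: fallback S c D _) (measurable_fibers_selection _)).
Qed.

Lemma measurable_repair U x t : measurable_fibers (repair U x t).
Proof.
case: t => [|t] /=; last first.
  exact: (measurable_fibers_comp (fun D => fallback S c D _)
    (measurable_fibers_selection _)).
exact: (measurable_fibers_comp (fun=> finset.set0) (measurable_fibers_selection 0)).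
Qed.

Lemma measurable_missed (x : 'rV[R]_m) u :
  measurable [set w | missed S (selection w x) u]%classic.
Proof.
exact: (measurable_fibers_comp (missed S ^~ u) (measurable_fibers_selection x) true).
Qed.

(** The weights [a] serve two purposes: constant 1 counts the fallback sets, and the cost of the
    cheapest set bounds their total cost. *)
Lemma mean_missed V (x : 'rV[R]_m) n (a : E -> R) (r : R) :
  fractional_set_cover S V x -> (#|` V| <= n)%N -> 0 <= r ->
  (forall u, u \in V -> 0 <= a u <= r) ->
  mean_le P (fun w => \sum_(u <- V) (missed S (selection w x) u)%:R * a u)
    (n%:R * expR (- rate) * r).
Proof.
move=> xV Vn r0 ar.
have h : mean_le P
    (fun w => \sum_(u <- V) (missed S (selection w x) u)%:R * a u)
    (\sum_(u <- V) expR (- rate) * a u).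
  apply: mean_le_sum_seq => u uV; have /andP[a0 _] := ar u uV.
  apply: mean_le_event => //; first exact: measurable_missed.
  exact: prob_missed xV uV.
have [mg g0 _] := h.
apply: mean_le_mono mg _ _ h => [w|]; first by rewrite g0 lexx.
apply: (@le_trans _ _ (\sum_(u <- V) expR (- rate) * r)).
  rewrite big_seq [leRHS]big_seq; apply: ler_sum => u uV.
  by rewrite ler_wpM2l ?expR_ge0//; case/andP: (ar u uV).
rewrite big_const_seq count_predT iter_addr_0 -mulrA -[leLHS]mulr_natl.
by rewrite ler_wpM2r ?ler_nat// mulr_ge0 ?expR_ge0.
Qed.

(** Time 0 is included because the first step of the recourse compares with it. *)
Lemma mean_card_repair U x T n t : fractional_solution S T U x ->
  (forall t, (1 <= t <= T)%N -> (#|` U t| <= n)%N) -> (t <= T)%N ->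
  mean_le P (fun w => #|repair U x t w|%:R) (n%:R * expR (- rate)).
Proof.
move=> [x0 xU] Un tT.
have mcard : measurable_fun setT (fun w => #|repair U x t w|%:R : R).
  exact: (measurable_fibers_fun (fun D : {set 'I_m} => #|D|%:R) (measurable_repair U x t)).
case: t => [|t] in tT mcard *.
  split => [||] //; rewrite [X in (X <= _)%E](_ : _ = 0%:E); last first.
    rewrite -[RHS](expectation_cst P 0); congr expectation.
    by apply/funext => w /=; rewrite cards0.
  by rewrite lee_fin mulr_ge0 ?expR_ge0.
have h := @mean_missed (U t.+1) (x t.+1) n (fun=> 1) 1 (xU t.+1 tT)
  (Un t.+1 tT) ler01.
apply: mean_le_mono mcard _ _ (h _) => [w||u _]; last by rewrite ler01 lexx.
  rewrite ler0n /=; under eq_bigr do rewrite mulr1.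
  by rewrite -natr_sum ler_nat; exact: card_fallback.
by rewrite mulr1.
Qed.

Lemma solution_ge0 U x T t i : fractional_solution S T U x -> (t <= T)%N ->
  0 <= x t ord0 i.
Proof.
move=> [x0 xU]; case: t => [|t] tT; first by rewrite x0 mxE.
by case: (xU t.+1 tT).
Qed.

(** The first term bounds the switches of the selection. The fallback sets at [t] and at [t.-1] are
    both charged in full, whence the factor 2. *)
Lemma mean_recourse_step U x T n t : fractional_solution S T U x ->
  (forall t, (1 <= t <= T)%N -> (#|` U t| <= n)%N) -> (1 <= t <= T)%N ->
  let z := fun t => (U t, x t) in
  mean_le P (fun w => #|symdiff (run (rounding w) z t) (run (rounding w) z t.-1)|%:R)
    (rate * l1norm (x t - x t.-1) + 2 * (n%:R * expR (- rate))).
Proof.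
move=> xU Un /andP[t1 tT] z.
have tT' : (t.-1 <= T)%N by rewrite (leq_trans (leq_pred _)).
have hits : mean_le P (fun w => \sum_i
      (hit i (x t ord0 i) w != hit i (x t.-1 ord0 i) w)%:R * 1)
    (\sum_i rate * `|x t ord0 i - x t.-1 ord0 i| * 1).
  apply: mean_le_sum => i _; apply: mean_le_event => //.
    exact: measurable_hit_neq.
  by rewrite distrC prob_hit_neq// (solution_ge0 _ xU).
have x0 : x 0%N = 0 by case: xU.
have := mean_leD hits (mean_leD (mean_card_repair xU Un tT)
  (mean_card_repair xU Un tT')).
apply: mean_le_mono => [|w|].
- under eq_fun do rewrite !run_rounding//.
  (* The recourse of the step is a function of four collections, so measurability follows from that
     of their joint fibers. *)
  have mr s : measurable_fibers (fun w => (selection w (x s), repair U x s w)).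
    by apply: measurable_fibers_pair;
      [exact: measurable_fibers_selection | exact: measurable_repair].
  exact: (measurable_fibers_fun
    (fun D : ({set 'I_m} * {set 'I_m}) * ({set 'I_m} * {set 'I_m}) =>
      #|symdiff (D.1.1 :|: D.1.2) (D.2.1 :|: D.2.2)|%:R)
    (measurable_fibers_pair (mr t) (mr t.-1))).
- rewrite ler0n /= !run_rounding//; under eq_bigr do rewrite mulr1.
  rewrite -natr_sum -!natrD ler_nat.
  apply: leq_trans (card_symdiff_setU _ _ _ _) _; rewrite leq_add2r card_symdiff.
  by rewrite leq_sum// => i _; rewrite !inE.
- rewrite /l1norm mulr_sumr mulr2n mulrDl mul1r lerD2r.
  by apply: ler_sum => i _; rewrite mulr1 !mxE.
Qed.

Lemma mean_recourse U x T n : fractional_solution S T U x ->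
  (forall t, (1 <= t <= T)%N -> (#|` U t| <= n)%N) ->
  let z := fun t => (U t, x t) in
  mean_le P (fun w => (recourse T (run (rounding w) z))%:R)
    (rate * movement T x + 2 * (T%:R * (n%:R * expR (- rate)))).
Proof.
move=> xU Un z.
rewrite [X in mean_le _ _ X](_ : _ = \sum_(1 <= t < T.+1)
   (rate * l1norm (x t - x t.-1) + 2 * (n%:R * expR (- rate)))); last first.
  rewrite big_split /= -mulr_sumr sumr_const_nat subn1 /= -mulr_natl.
  by congr (_ + _); ring.
rewrite /recourse; under eq_fun do rewrite natr_sum.
apply: mean_le_sum_seq => t; rewrite mem_index_iota ltnS => tT.
exact: mean_recourse_step xU Un tT.
Qed.

(** Selected sets contribute [rate] times the fractional cost, by [1 - expR (- y) <= y]. Fallback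
    sets contribute the other summand, by [mean_missed] with weights bounded by [cost_cheapest]. *)
Lemma mean_cost U x T n t : fractional_solution S T U x ->
  (forall t, (1 <= t <= T)%N -> (#|` U t| <= n)%N) -> (1 <= t <= T)%N ->
  let z := fun t => (U t, x t) in
  mean_le P (fun w => cost c (run (rounding w) z t))
    ((rate + n%:R * expR (- rate)) * fractional_cost c (x t)).
Proof.
move=> xU Un tT z; have x_ge0 i : 0 <= x t ord0 i.
  by apply: solution_ge0 xU _; case/andP: tT.
have hits : mean_le P (fun w => \sum_i (hit i (x t ord0 i) w)%:R * c i)
    (\sum_i rate * x t ord0 i * c i).
  apply: mean_le_sum => i _; apply: mean_le_event => //.
    exact: measurable_hit.
  rewrite prob_hit// lee_fin; have := expR_ge1Dx (- rate * x t ord0 i); lra.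
have fc0 : 0 <= fractional_cost c (x t).
  by apply: sumr_ge0 => i _; rewrite mulr_ge0.
have xt : fractional_set_cover S (U t) (x t) by case: xU => _; apply.
have missing : mean_le P
   (fun w => \sum_(u <- U t) (missed S (selection w (x t)) u)%:R * cost c (cheapest S c u))
   (n%:R * expR (- rate) * fractional_cost c (x t)).
  apply: mean_missed => //; first exact: Un.
  by move=> u uU; rewrite cost_ge0//= (cost_cheapest _ xt).
have x0 : x 0%N = 0 by case: xU.
have := mean_leD hits missing.
apply: mean_le_mono => [|w|].
- have mrun : measurable_fibers (fun w => run (rounding w) z t).
    by case: t tT {x_ge0 hits fc0 xt missing} => // t _; exact: measurable_rounding.
  exact: measurable_fibers_fun mrun.
- rewrite cost_ge0//= run_rounding//.
  apply: le_trans (cost_setU _ _ _) _ => //; apply: lerD.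
    rewrite /cost big_mkcond /=; apply: ler_sum => i _; rewrite inE.
    by case: (hit _ _ _); rewrite ?mul1r ?mul0r.
  by case: t tT {x_ge0 hits fc0 xt missing} => // t _; exact: cost_fallback.
- rewrite mulrDl lerD2r /fractional_cost mulr_sumr.
  by apply: ler_sum => i _; rewrite -mulrA [x t ord0 i * _]mulrC.
Qed.

End Selection.

(** * Assembling the randomized scheme and choosing the rate *)

Lemma exists_rounding (R : realType) (E : choiceType) (m : nat)
    (S : 'I_m -> set E) (c : 'I_m -> R) (rate : R) :
  (forall i, 0 <= c i) -> 0 < rate ->
  exists (d : measure_display) (Omega : measurableType d)
         (P : probability Omega R)
         (A : Omega -> scheme ({fset E} * 'rV[R]_m) m),
    measurable_scheme A /\
    forall (T n : nat) (U : nat -> {fset E}) (x : nat -> 'rV[R]_m),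
      dynamic_instance S T U -> fractional_solution S T U x ->
      (forall t, (1 <= t <= T)%N -> (#|` U t| <= n)%N) ->
      let z := fun t => (U t, x t) in
      [/\ forall w t, (1 <= t <= T)%N -> set_cover S (U t) (run (A w) z t),
          ('E_P[fun w => (recourse T (run (A w) z))%:R] <=
             (rate * movement T x + 2 * (T%:R * (n%:R * expR (- rate))))%:E)%E
        & forall t, (1 <= t <= T)%N ->
            ('E_P[fun w => cost c (run (A w) z t)] <=
             ((rate + n%:R * expR (- rate)) * fractional_cost c (x t))%:E)%E].
Proof.
move=> c0 rate0; have [Q QE] := exponential_probability rate0.
(* The probability space depends only on [rate] and [m], so the seed is fixed before the input. *)
have [d [ Omega [P [X [mX indX]]]]] := iid_copies Q m.
have XE (A : 'I_m -> set (measurableTypeR R)) : (forall i, measurable (A i)) ->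
    P [set w | forall i, A i (X i w)]%classic =
    (\prod_i fine (exponential_prob rate (A i)))%:E.
  by move=> mA; rewrite indX//; under eq_bigr do rewrite QE.
exists d, Omega, P, (rounding S X c); split; first exact: measurable_rounding.
move=> T n U x dynU xU Un z; split.
- move=> w t /[dup] tT /dynU [_ cov]; have [x0 _] := xU.
  rewrite run_rounding//; case: t tT cov => // t _ cov.
  exact: fallback_set_cover.
- by have [] := mean_recourse rate0 mX XE c xU Un.
- by move=> t tT; have [] := mean_cost rate0 mX XE c0 xU Un tT.
Qed.

(** For [n > 0] the left side equals [expR (- 1) / alpha]; for [n = 0] it vanishes. It bounds the
    expected number of missed elements at one time. *)
Lemma mulr_expRN_ln_le (R : realType) (n : nat) (alpha : R) : 1 <= alpha ->
  n%:R * expR (- (1 + ln (alpha * n%:R))) <= alpha^-1.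
Proof.
move=> a1; have a0 : 0 < alpha by lra.
case: n => [|n]; first by rewrite mul0r invr_ge0 ltW.
have an0 : 0 < alpha * n.+1%:R by rewrite mulr_gt0.
rewrite opprD expRD (expRN (ln _)) lnK ?posrE//.
apply: (@le_trans _ _ (n.+1%:R * (1 * (alpha * n.+1%:R)^-1))).
  by rewrite ler_wpM2l// ler_wpM2r ?invr_ge0 ?(ltW an0)//.
by rewrite mul1r invfM mulrCA divff ?mulr1// pnatr_eq0.
Qed.

Lemma ln_mulrn_ge0 (R : realType) (n : nat) (alpha : R) : 1 <= alpha ->
  0 <= ln (alpha * n%:R).
Proof.
(* For [n = 0] the convention [ln 0 = 0] applies, so the rate is then 1. *)
move=> a1; case: n => [|n]; first by rewrite mulr0 ln0.
by rewrite ln_ge0// (le_trans a1)// ler_peMr ?ler1n// (le_trans ler01).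
Qed.

Theorem theorem4p1 (R : realType) :
  (exists C : R, 0 < C /\
    forall (m : nat) (E : choiceType) (S : 'I_m -> set E) (c : 'I_m -> R)
           (f : nat),
      (forall i, 0 <= c i) ->
      exists A : scheme 'rV[R]_m m,
        forall (T : nat) (U : nat -> {fset E}) (x : nat -> 'rV[R]_m),
          dynamic_instance S T U ->
          fractional_solution S T U x ->
          (forall t, (1 <= t <= T)%N ->
             forall u, u \in U t -> (frequency S u <= f)%N) ->
          [/\ forall t, (1 <= t <= T)%N -> set_cover S (U t) (run A x t),
              (recourse T (run A x))%:R <= C * f%:R * movement T x
            & forall t, (1 <= t <= T)%N ->
                cost c (run A x t) <= C * f%:R * fractional_cost c (x t)])
  /\
  (exists C : R, 0 < C /\
    forall (m : nat) (E : choiceType) (S : 'I_m -> set E) (c : 'I_m -> R)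
           (n : nat) (alpha : R),
      (forall i, 0 <= c i) ->
      1 <= alpha ->
      exists (d : measure_display) (Omega : measurableType d)
             (P : probability Omega R)
             (A : Omega -> scheme ({fset E} * 'rV[R]_m) m),
        measurable_scheme A /\
        forall (T : nat) (U : nat -> {fset E}) (x : nat -> 'rV[R]_m),
          dynamic_instance S T U ->
          fractional_solution S T U x ->
          (forall t, (1 <= t <= T)%N -> (#|` U t| <= n)%N) ->
          let z := fun t => (U t, x t) in
          [/\ forall w t, (1 <= t <= T)%N ->
                set_cover S (U t) (run (A w) z t),
              ('E_P[fun w => (recourse T (run (A w) z))%:R] <=
                 (C * (1 + ln (alpha * n%:R)) * movement T x
                  + C * (T%:R / alpha))%:E)%E
            & forall t, (1 <= t <= T)%N ->
                ('E_P[fun w => cost c (run (A w) z t)] <=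
                   (C * (1 + ln (alpha * n%:R))
                      * fractional_cost c (x t))%:E)%E]).
Proof.
(* In (1) the constant 2 comes from the lower threshold [1/(2f)]. In (2) it comes from the two
   repairs charged per step, and for the cost from [rate + alpha^-1 <= 2 * rate]. *)
split; exists 2; split=> //.
  move=> m E S c f c0; exists (hysteresis_scheme f) => T U x dynU xU freq.
  have [x0 x_cov] := xU.
  split; [|exact: hysteresis_recourse|]; move=> [//|t] tT.
    rewrite run_hysteresisS; apply: hysteresis_set_cover; first exact: x_cov.
    exact: freq.
  rewrite run_hysteresisS; apply: hysteresis_cost => // i.
  by case: (x_cov _ tT).
move=> m E S c n alpha c0 a1.
have ln0 := ln_mulrn_ge0 n a1; have expn := mulr_expRN_ln_le n a1.
(* Together with [1 <= rate], this absorbs the fallback cost into a second multiple of [rate]. *)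
have a_inv1 : alpha^-1 <= 1 by rewrite invf_le1//; lra.
set rate := 1 + ln (alpha * n%:R) in expn *.
have rate1 : 1 <= rate by rewrite lerDl.
have rate0 : 0 < rate by lra.
have [d [ Omega [P [A [mA AE]]]]] := exists_rounding S c0 rate0.
exists d, Omega, P, A; split => // T U x dynU xU Un z.
have [cov rec costs] := AE T n U x dynU xU Un; split => //.
- apply: le_trans rec _; rewrite lee_fin lerD//.
    have mv0 : 0 <= movement T x.
      by apply: sumr_ge0 => t _; apply: sumr_ge0.
    by rewrite ler_wpM2r// ler_peMl ?ler1n// ltW.
  by rewrite ler_wpM2l// ler_wpM2l.
- move=> t tT; apply: le_trans (costs t tT) _; rewrite lee_fin.
  apply: ler_wpM2r; last lra.
  apply: sumr_ge0 => i _; rewrite mulr_ge0//.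
  by case/andP: tT => _; exact: (solution_ge0 _ xU).
Qed.
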